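(* Let the standing assumptions of the context hold with $C=\mathbb R^n$ (i.e. $h$ has full domain) and let $(\gamma,\beta,c,\xi)$ be admissible. Consider iterates generated by the $i^*$FRB linesearch algorithm described in the context. Suppose further that $f,h\in\mathcal C^2$ with $\nabla^2h\succ0$, and that $(x^k)_{k\in\mathbb N}$ converges to a strong local minimum $x^\star$ for $\varphi$ satisfying $T_{\gamma,\beta}(x^\star,x^\star)=\{x^\star\}$. If the directions $(d^k)_{k\in\mathbb N}$ are superlinearly convergent with respect to $(x^k)_{k\in\mathbb N}$, then eventually $\tau_k=1$ is always accepted in the linesearch, and the algorithm reduces to the local method $x^{k+1}=x^k+d^k$ and converges at superlinear rate.
   Context: Conventions: $\overline{\mathbb R}=\mathbb R\cup\{\pm\infty\}$, $\infty-\infty=\infty$, $1/0=\infty$; $\operatorname{dom}F=\{F<\infty\}$; $\operatorname{argmin}F=\{w: F(w)\le F(z)\ \forall z\}$. 1-coercive: $F(x)/\|x\|\to\infty$ as $\|x\|\to\infty$. A point $x^\star\in\operatorname{dom}\varphi$ is a strong local minimum for $\varphi$ if there is $\mu>0$ with $\varphi(x)\ge\varphi(x^\star)+\frac\mu2\|x-x^\star\|^2$ for all $x$ in a neighborhood of $x^\star$. Relative to a sequence $(x^k)$ converging to $x^\star$, directions $(d^k)$ are superlinearly convergent if $\lim_{k\to\infty}\|x^k+d^k-x^\star\|/\|x^k-x^\star\|=0$. $(x^k)$ converges at superlinear rate if $\|x^{k+1}-x^\star\|/\|x^k-x^\star\|\to0$. Kernel. $C\subseteq\mathbb R^n$ is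 a nonempty open convex set with closure $\overline C$, and $h:\mathbb R^n\to\overline{\mathbb R}$ is a Legendre kernel: proper, lsc, strictly convex, 1-coercive, differentiable on $C$, with $\operatorname{dom}\nabla h=\operatorname{int}\operatorname{dom}h=C$, and essentially smooth ($\|\nabla h(x_k)\|\to\infty$ for every sequence in $C$ converging to a boundary point of $C$). For $\psi$ differentiable on $C$ (not necessarily convex) and $y\in C$, $D_\psi(x,y):=\psi(x)-\psi(y)-\langle\nabla\psi(y),x-y\rangle$. Problem and standing assumptions. $\varphi:=f+g$ and $\varphi_{\overline C}:=\varphi+\delta_{\overline C}$ ($\delta$ the indicator function). (1) $f:\mathbb R^n\to\overline{\mathbb R}$ is proper, lsc, differentiable on $\operatorname{int}\operatorname{dom}f\ne\emptyset$, and smooth relative to $h$: $\operatorname{dom}f\supseteq\operatorname{dom}h$ and $Lh\pm f$ are convex on $C$ for some $L\ge0$. (2) $g:\mathbb R^n\to\overline{\mathbb R}$ is proper and lsc. (3) $\inf\varphi_{\overline C}>-\infty$. (4) For all $v\in\mathbb R^n$, $\gamma>0$: $\operatorname{argmin}\{\gamma g+h-\langle v,\cdot\rangle\}\subseteq C$. Constants. Fix $\sigma_{f,h},\sigma_{-f,h}\in\mathbb R$ such that $f-\sigma_{f,h}h$ and $-f-\sigma_{-f,h}h$ are convex on $C$. $L_{f,h}:=\max\{|\sigma_{f,h}|,|\sigma_{-f,h}|\}$, assumed positive ($f$ not affine); $p_{\pm f,h}:=\sigma_{\pm f,h}/L_{f,h}$; $\alpha:=\gamma L_{f,h}$ for a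 stepsize $\gamma>0$. Model, operator, envelope. For $\gamma>0$, $\beta\in\mathbb R$ let $\hat h:=\frac1\gamma h-f$, $\hat f_\beta:=f-\frac\beta\gamma h$, and for $w\in\mathbb R^n$, $x,x^-\in C$, $$\mathcal M_{\gamma,\beta}(w;x,x^-):=\varphi(w)+D_{\hat h}(w,x)+\langle w-x,\nabla\hat f_\beta(x)-\nabla\hat f_\beta(x^-)\rangle,$$ $T_{\gamma,\beta}(x,x^-):=\operatorname{argmin}_w\mathcal M_{\gamma,\beta}(w;x,x^-)$, $\Phi_{\gamma,\beta}(x,x^-):=\inf_w\mathcal M_{\gamma,\beta}(w;x,x^-)$. Admissible parameters. $(\gamma,\beta,c,\xi)$ with $\gamma>0$, $\beta\in\mathbb R$ is admissible if either (A) $\hat f_\beta$ is convex on $C$ (i.e. $\alpha p_{f,h}-\beta\ge0$), $\beta>-\frac{1+3\alpha p_{-f,h}}2$, $\xi=\hat f_\beta$ and $c=1+2\beta+3\alpha p_{-f,h}>0$; or (B) $\nabla\hat f_\beta$ is $L_{\hat f_\beta}$-Lipschitz on $C$, $h$ is $\sigma_h$-strongly convex ($\sigma_h>0$), $\xi=\frac{L_{\hat f_\beta}}2\|\cdot\|^2$ and $c=(1+\alpha p_{-f,h})\sigma_h-2\gamma L_{\hat f_\beta}>0$. In either case $\mathcal L_{\gamma,\beta}(x,x^-):=\Phi_{\gamma,\beta}(x,x^-)+\frac c{2\gamma}D_h(x,x^-)+D_\xi(x,x^-)$ on $C\times C$. $i^*$FRB linesearch algorithm. Choose $x^{-1},x^0\in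 C$, $\delta\in(0,1)$, and set $y^{-1}=x^{-1}$. For $k=0,1,\dots$: compute $\bar x^k\in T_{\gamma,\beta}(x^k,y^{k-1})$; choose an update direction $d^k\in\mathbb R^n$ at $x^k$; set $y^k=x^k+\tau_kd^k$ and $x^{k+1}=(1-\tau_k)\bar x^k+\tau_k(x^k+d^k)$, with $\tau_k$ the largest in $\{1,\frac12,\frac14,\dots\}$ such that $$\mathcal L_{\gamma,\beta}(x^{k+1},y^k)\le\mathcal L_{\gamma,\beta}(x^k,y^{k-1})-\tfrac{\delta c}{2\gamma}\bigl(D_h(\bar x^k,x^k)+D_h(x^k,y^{k-1})\bigr).$$ *)

(* Defs.v *)
From HB Require Import structures.
From mathcomp Require Import all_boot all_order all_algebra.
From mathcomp Require Import all_classical all_reals all_analysis.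

Set Implicit Arguments.
Unset Strict Implicit.
Unset Printing Implicit Defensive.

Import Order.TTheory GRing.Theory Num.Theory.
Import numFieldNormedType.Exports.

Local Open Scope classical_set_scope.
Local Open Scope ring_scope.

Section euclidean.
Variables (R : realType) (n : nat).
Local Notation V := 'rV[R]_n.

Definition dotp (u v : V) : R := \sum_i u 0 i * v 0 i.

(* The norm `|x| of the library on 'rV[R]_n is the sup norm. It induces the same
   topology, but the constants in strong convexity, Lipschitz continuity and
   quadratic growth refer to the Euclidean norm. *)
Definition enorm (u : V) : R := Num.sqrt (dotp u u).

Definition grad (u : V -> R) (x : V) : V := \row_i 'D_(delta_mx 0 i) u x.

Definition hess (u : V -> R) (x : V) : 'M[R]_n :=
  \matrix_(i, j) 'D_(delta_mx 0 j) (fun z => grad u z 0 i) x.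

Definition C2 (u : V -> R) : Prop :=
  [/\ forall x, differentiable u x,
      forall x, differentiable (grad u) x
    & continuous (hess u)].

Definition posdef (A : 'M[R]_n) : Prop :=
  forall v : V, v != 0 -> 0 < dotp (v *m A) v.

End euclidean.

(* Sums of extended reals are taken with the dual addition of the scope %dE,
   for which oo - oo = oo. The real-valued part of F on its domain, in
   particular for gradients and for convexity on C, is fine \o F. *)
Section extended_real_functions.
Variables (R : realType) (n : nat).
Local Notation V := 'rV[R]_n.
Implicit Types (F psi : V -> \bar R) (C : set V).

Definition edom F : set V := [set x | (F x < +oo)%E].

Definition eproper F : Prop :=
  (forall x, F x != -oo%E) /\ edom F !=set0.

Definition argmin F : set V := [set w | forall z, (F w <= F z)%E].

Definition indic C : V -> \bar R := fun x => if x \in C then 0%E else +oo%E.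

Definition egrad F : V -> V := grad (fine \o F).

Definition dom_egrad F : set V :=
  [set x | (edom F)° x /\ differentiable (fine \o F) x].

Definition coercive1 F : Prop :=
  forall M : R, exists r : R, forall x : V,
    r <= enorm x -> (M%:E <= F x / (enorm x)%:E)%E.

Definition strictly_convex F : Prop :=
  forall (x y : V) (t : R), edom F x -> edom F y -> x != y -> 0 < t < 1 ->
    (F (t *: x + (1 - t) *: y)%R < t%:E * F x + (1 - t)%:E * F y)%dE.

Definition strongly_convex (s : R) F : Prop :=
  convex_set (edom F : set (convex_lmodType V)) /\
  convex_function (edom F) (fun x : V => fine (F x) - s / 2 * enorm x ^+ 2).

Definition lipschitz_grad C (L : R) F : Prop :=
  0 <= L /\
  forall x y, C x -> C y -> enorm (egrad F x - egrad F y) <= L * enorm (x - y).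

Definition breg psi (x y : V) : \bar R :=
  (psi x - psi y - (dotp (egrad psi y) (x - y)%R)%:E)%dE.

Definition strong_local_min F (xs : V) : Prop :=
  edom F xs /\
  exists2 mu : R, 0 < mu &
    \forall x \near xs, (F xs + (mu / 2 * enorm (x - xs) ^+ 2)%:E <= F x)%dE.

End extended_real_functions.

(* The quotients are taken in \bar R, where a / 0 = +oo for a > 0 and
   0 / 0 = 0: where u k = xs, a small quotient thus forces v k = xs. *)
Definition superlinear (R : realType) (n : nat) (v u : nat -> 'rV[R]_n)
    (xs : 'rV[R]_n) : Prop :=
  ((enorm (v k - xs))%:E / (enorm (u k - xs))%:E)%E @[k --> \oo] --> (0 : \bar R)%E.

Definition superlinear_directions (R : realType) (n : nat)
    (d x : nat -> 'rV[R]_n) (xs : 'rV[R]_n) : Prop :=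
  superlinear (fun k => x k + d k) x xs.

Definition superlinear_rate (R : realType) (n : nat)
    (x : nat -> 'rV[R]_n) (xs : 'rV[R]_n) : Prop :=
  superlinear (fun k => x k.+1) x xs.

Section problem.
Variables (R : realType) (n : nat).
Local Notation V := 'rV[R]_n.
Variables (C : set V) (f g h : V -> \bar R).

Definition legendre_kernel : Prop :=
  [/\ [/\ C !=set0, open C & convex_set (C : set (convex_lmodType V))],
      [/\ eproper h, lower_semicontinuous h, strictly_convex h & coercive1 h],
      dom_egrad h = C, (edom h)° = C
    & forall (u : nat -> V) (p : V), (forall k, C (u k)) ->
        (closure C `\` C) p -> u @ \oo --> p ->
        enorm (egrad h (u k)) @[k --> \oo] --> +oo].

Definition relatively_smooth : Prop :=
  edom h `<=` edom f /\
  exists2 L : R, 0 <= L &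
    convex_function C (fun x : V => L * fine (h x) + fine (f x)) /\
    convex_function C (fun x : V => L * fine (h x) - fine (f x)).

Definition phi (w : V) : \bar R := (f w + g w)%dE.

Definition phi_cl (w : V) : \bar R := (phi w + indic (closure C) w)%dE.

Definition standing_assumptions : Prop :=
  [/\ legendre_kernel,
      [/\ eproper f, lower_semicontinuous f, (edom f)° !=set0,
          (forall x, (edom f)° x -> differentiable (fine \o f) x)
        & relatively_smooth],
      eproper g /\ lower_semicontinuous g,
      (-oo < ereal_inf (range phi_cl))%E
    & forall (v : V) (gamma : R), 0 < gamma ->
        argmin (fun w => (gamma%:E * g w + h w - (dotp v w)%:E)%dE) `<=` C].

Section constants.
Variables sf smf : R. (* sigma_{f,h} and sigma_{-f,h} *)

Definition L_fh : R := Num.max `|sf| `|smf|.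

Definition p_fh : R := sf / L_fh.

Definition p_mfh : R := smf / L_fh.

Definition relative_constants : Prop :=
  [/\ convex_function C (fun x : V => fine (f x) - sf * fine (h x)),
      convex_function C (fun x : V => - fine (f x) - smf * fine (h x))
    & 0 < L_fh].

End constants.

Section model.
Variables gamma beta : R.

Definition hhat (w : V) : \bar R := ((gamma^-1)%:E * h w - f w)%dE.

Definition fhat (w : V) : \bar R := (f w - (beta / gamma)%:E * h w)%dE.

Definition model (x xm w : V) : \bar R :=
  (phi w + breg hhat w x + (dotp (w - x) (egrad fhat x - egrad fhat xm))%:E)%dE.

Definition T_op (x xm : V) : set V := argmin (model x xm).

Definition envelope (x xm : V) : \bar R := ereal_inf (range (model x xm)).

Definition admissible (sf smf c : R) (xi : V -> \bar R) : Prop :=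
  let alpha := gamma * L_fh sf smf in
  let pm := p_mfh sf smf in
  0 < gamma /\
  ([/\ convex_function C (fun x : V => fine (fhat x)),
       beta > - ((1 + 3 * (alpha * pm)) / 2),
       xi = fhat,
       c = 1 + 2 * beta + 3 * (alpha * pm)
     & 0 < c]
   \/
   exists Lhat sh : R,
   [/\ lipschitz_grad C Lhat fhat,
       0 < sh /\ strongly_convex sh h,
       xi = (fun x => (Lhat / 2 * enorm x ^+ 2)%:E),
       c = (1 + alpha * pm) * sh - 2 * gamma * Lhat
     & 0 < c]).

Variables (c : R) (xi : V -> \bar R).

Definition lyapunov (x xm : V) : \bar R :=
  (envelope x xm + (c / (2 * gamma))%:E * breg h x xm + breg xi x xm)%dE.

Section linesearch.
Variable delta : R.

(* ym plays the role of y^{k-1}. *)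
Definition trial_y (x d : V) (t : R) : V := x + t *: d.

Definition trial_x (x xbar d : V) (t : R) : V :=
  (1 - t) *: xbar + t *: (x + d).

Definition accepted (x ym xbar d : V) (t : R) : Prop :=
  [/\ C (trial_x x xbar d t), C (trial_y x d t)
    & (lyapunov (trial_x x xbar d t) (trial_y x d t) <=
       lyapunov x ym
       - (delta * c / (2 * gamma))%:E * (breg h xbar x + breg h x ym))%dE].

Definition largest_accepted (x ym xbar d : V) (t : R) : Prop :=
  [/\ exists j : nat, t = 2 ^- j, accepted x ym xbar d t
    & forall j : nat, accepted x ym xbar d (2 ^- j) -> 2 ^- j <= t].

(* x^{-1} = y^{-1} is xm1, and y_prev xm1 y k is y^{k-1}. *)
Definition y_prev (xm1 : V) (y : nat -> V) (k : nat) : V :=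
  if k is j.+1 then y j else xm1.

Definition ifrb_iterates (xm1 : V) (x xbar d y : nat -> V) (tau : nat -> R)
    : Prop :=
  [/\ C xm1, C (x 0%N), 0 < delta < 1
    & forall k : nat, let ym := y_prev xm1 y k in
      [/\ T_op (x k) ym (xbar k),
          largest_accepted (x k) ym (xbar k) (d k) (tau k),
          y k = trial_y (x k) (d k) (tau k)
        & x k.+1 = trial_x (x k) (xbar k) (d k) (tau k)]].

End linesearch.
End model.
End problem.

(* Main.v *)
Require Import Defs.
From mathcomp Require Import all_boot all_order all_algebra.
From mathcomp Require Import all_classical all_reals all_analysis.
From mathcomp Require Import ring lra.

(** Why the unit step is eventually accepted.  Write [L] for the Lyapunov
    function, [phi*] for [phi xs], and [z] for the full-step point [x k + d k].
    Two estimates near the limit point carry the proof.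

    Above ([lyapunov_diag_le]): evaluating the infimum that defines the envelope
    at [xs] gives [L(z, z) <= phi* + D_hhat(xs, z)], and the Bregman distance of
    a C2 function is at most quadratic near [xs]; so
    [L(z, z) <= phi* + K |z - xs|^2].

    Below ([lyapunov_near_ge]): for [(x, x')] close to [(xs, xs)] such that the
    model has a minimizer [w],
    [L(x, x') >= phi* + k (|x - xs|^2 + |x - x'|^2)] with [k > 0].  Besides
    [c / (2 gamma) D_h(x, x')], which controls [|x - x'|^2] because [h] is locally
    strongly convex ([posdef_bregR_near]), [L(x, x')] consists of [phi w] and of
    Bregman terms that either form of admissibility bounds from below by a
    positive multiple of [|w - x|^2] ([admissible_merit_ge]).  Quadratic growth
    of [phi] at [xs] supplies [|w - xs|^2], once [w] is known to be close to
    [xs]; this is [near_argmin], and it is where [T(xs, xs) = {xs}] is used.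

    If at some late iteration the unit step were refused, a step [tau <= 1/2]
    would be accepted, and both tests have the same right-hand side.  Hence
    [L(x (k+1), y k) < L(z, z)], and the two estimates give
    [k (|x (k+1) - xs|^2 + |x (k+1) - y k|^2) < K |z - xs|^2].  If [x k = xs],
    then [z = xs] and this is absurd.  Otherwise the right-hand side is
    negligible with respect to [|x k - xs|^2], so the same is true of
    [|y k - xs|^2]; but [y k] has covered at most half of the way from [x k] to
    [z], so that [|y k - xs|] is about [|x k - xs| / 2] or more, a contradiction
    ([short_step_far]).  Only the values of [L] at the two trial points are
    compared, so that the decrease requested by the linesearch cancels out. *)

Set Implicit Arguments.
Unset Strict Implicit.
Unset Printing Implicit Defensive.

Import Order.TTheory GRing.Theory Num.Theory.
Import numFieldNormedType.Exports DualAddTheory.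
Local Open Scope classical_set_scope.
Local Open Scope ring_scope.

(** * Euclidean geometry of row vectors *)

Section EuclideanSpace.
Context {R : realType} {n : nat}.
Implicit Types (u v w x y z : 'rV[R]_n) (a b : R).

Lemma dotpC u v : dotp u v = dotp v u.
Proof. by apply: eq_bigr => i _; rewrite mulrC. Qed.

Lemma dotpDl u v w : dotp (u + v) w = dotp u w + dotp v w.
Proof. by rewrite -big_split; apply: eq_bigr => i _; rewrite mxE mulrDl. Qed.

Lemma dotpZl a u v : dotp (a *: u) v = a * dotp u v.
Proof. by rewrite mulr_sumr; apply: eq_bigr => i _; rewrite mxE mulrA. Qed.

Lemma dotpNl u v : dotp (- u) v = - dotp u v.
Proof. by rewrite -scaleN1r dotpZl mulN1r. Qed.

Lemma dotpBl u v w : dotp (u - v) w = dotp u w - dotp v w.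
Proof. by rewrite dotpDl dotpNl. Qed.

Lemma dotpDr u v w : dotp u (v + w) = dotp u v + dotp u w.
Proof. by rewrite dotpC dotpDl !(dotpC u). Qed.

Lemma dotpZr a u v : dotp u (a *: v) = a * dotp u v.
Proof. by rewrite dotpC dotpZl dotpC. Qed.

Lemma dotpNr u v : dotp u (- v) = - dotp u v.
Proof. by rewrite dotpC dotpNl dotpC. Qed.

Lemma dotpBr u v w : dotp u (v - w) = dotp u v - dotp u w.
Proof. by rewrite dotpDr dotpNr. Qed.

Lemma dotp0r u : dotp u 0 = 0.
Proof. by rewrite -(scale0r 0) dotpZr mul0r. Qed.

Lemma dotp_ge0 u : 0 <= dotp u u.
Proof. by apply: sumr_ge0 => i _; rewrite -expr2 sqr_ge0. Qed.

Lemma dotp_eq0 u : (dotp u u == 0) = (u == 0).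
Proof.
apply/idP/eqP => [|->]; last by rewrite dotp0r.
rewrite psumr_eq0 => [/allP u0|i _]; last by rewrite -expr2 sqr_ge0.
apply/rowP => i; apply/eqP; rewrite mxE.
by have := u0 i (mem_index_enum i); rewrite mulf_eq0 orbb.
Qed.

Lemma enorm_ge0 u : 0 <= enorm u.
Proof. exact: sqrtr_ge0. Qed.

Lemma sqr_enorm u : enorm u ^+ 2 = dotp u u.
Proof. by rewrite sqr_sqrtr ?dotp_ge0. Qed.

Lemma enorm_eq0 u : (enorm u == 0) = (u == 0).
Proof. by rewrite -dotp_eq0 -sqr_enorm expf_eq0. Qed.

Lemma enorm0 : enorm (0 : 'rV[R]_n) = 0.
Proof. by apply/eqP; rewrite enorm_eq0. Qed.

Lemma enormZ a u : enorm (a *: u) = `|a| * enorm u.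
Proof.
by rewrite /enorm dotpZl dotpZr mulrA -expr2 sqrtrM ?sqr_ge0// sqrtr_sqr.
Qed.

Lemma enormN u : enorm (- u) = enorm u.
Proof. by rewrite -scaleN1r enormZ normrN1 mul1r. Qed.

Lemma enorm_distC u v : enorm (u - v) = enorm (v - u).
Proof. by rewrite -enormN opprB. Qed.

(** Cauchy-Schwarz. *)
Lemma dotp_le u v : dotp u v <= enorm u * enorm v.
Proof.
have [->|u0] := eqVneq u 0; first by rewrite enorm0 mul0r dotpC dotp0r.
have [->|v0] := eqVneq v 0; first by rewrite enorm0 mulr0 dotp0r.
(* This vector vanishes exactly in the case of equality. *)
have := dotp_ge0 (enorm v *: u - enorm u *: v).
rewrite dotpBl !dotpBr !dotpZl !dotpZr -!sqr_enorm (dotpC v u).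
have u_gt0 : 0 < enorm u by rewrite lt_neqAle eq_sym enorm_eq0 u0 enorm_ge0.
have v_gt0 : 0 < enorm v by rewrite lt_neqAle eq_sym enorm_eq0 v0 enorm_ge0.
move=> h; rewrite -(ler_pM2l (mulr_gt0 u_gt0 v_gt0)); nra.
Qed.

Lemma enormD u v : enorm (u + v) <= enorm u + enorm v.
Proof.
rewrite -(@ler_pXn2r _ 2) ?nnegrE ?addr_ge0 ?enorm_ge0//.
rewrite sqr_enorm dotpDl !dotpDr (dotpC v u) -!sqr_enorm.
by have := dotp_le u v; nra.
Qed.

Lemma enorm_triangle w u v : enorm (u - v) <= enorm (u - w) + enorm (w - v).
Proof. by rewrite -[u - v](subrKA w) enormD. Qed.

Lemma mx_norm_le_enorm u : `|u| <= enorm u.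
Proof.
rewrite [leLHS]mx_normrE (bigmax_le _ (enorm_ge0 _))// => -[i j] _ /=.
rewrite (ord1 i) -(@ler_pXn2r _ 2) ?nnegrE ?enorm_ge0// sqr_enorm.
rewrite /dotp (bigD1 j)//= real_normK ?num_real// expr2 lerDl.
by apply: sumr_ge0 => k _; rewrite -expr2 sqr_ge0.
Qed.

Lemma cvg_coord {T : Type} {F : set_system T} {FF : Filter F}
    (f : T -> 'rV[R]_n) u i :
  f @ F --> u -> f t 0 i @[t --> F] --> u 0 i.
Proof.
move=> fu; apply: (@cvg_comp _ _ _ f (fun M : 'rV[R]_n => M 0 i) _ _ _ fu).
exact: coord_continuous.
Qed.

Lemma cvg_dotp {T : Type} {F : set_system T} {FF : Filter F}
    (f g : T -> 'rV[R]_n) u v :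
  f @ F --> u -> g @ F --> v -> dotp (f t) (g t) @[t --> F] --> dotp u v.
Proof.
move=> fu gv; apply: cvg_big => [|i _]; first exact: add_continuous.
by apply: cvgM; exact: cvg_coord.
Qed.

Lemma cvg_enorm {T : Type} {F : set_system T} {FF : Filter F}
    (f : T -> 'rV[R]_n) u :
  f @ F --> u -> enorm (f t) @[t --> F] --> enorm u.
Proof.
move=> fu; have sc : {for dotp u u, continuous (@Num.sqrt R)}.
  exact: sqrt_continuous.
exact: (continuous_cvg _ sc (cvg_dotp fu fu)).
Qed.

Lemma cvg_enormB x z : enorm (y - x) @[y --> z] --> enorm (z - x).
Proof.
have zx : y - x @[y --> z] --> z - x.
  exact: (@cvgB R 'rV[R]_n _ (nbhs z) _ id (fun=> x) z x cvg_id (cvg_cst _)).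
exact: (cvg_enorm zx).
Qed.

(** The topology comes from the sup norm; this lemma and the next ones let
    neighborhoods and compactness be handled with Euclidean balls. *)
Lemma near_enormP x (P : set 'rV[R]_n) :
  (\forall z \near x, P z) <->
  exists2 r : R, 0 < r & forall z, enorm (z - x) < r -> P z.
Proof.
split=> [/nbhs_ballP[r /= r0 rP]|[r r0 rP]].
  exists r => // z zr; apply: rP; rewrite -ball_normE /ball_/= distrC.
  exact: le_lt_trans (mx_norm_le_enorm _) zr.
have := @cvg_enormB x x.
rewrite subrr enorm0 => /cvgr_lt /(_ r r0).
by apply: filterS => z; exact: rP.
Qed.

Lemma compact_enorm_ball x (r : R) : compact [set z | enorm (z - x) <= r].
Proof.
apply: bounded_closed_compact.
  exists (r + enorm x); split; first exact: num_real.
  move=> M rM z /= zr; apply: le_trans (ltW rM).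
  apply: (le_trans (mx_norm_le_enorm z)).
  by rewrite -[z](subrK x) (le_trans (enormD _ _))// lerD2r.
have -> : [set z | enorm (z - x) <= r] =
    (fun z => enorm (z - x)) @^-1` [set a | a <= r] by [].
apply: closed_comp; last exact: closed_le.
by move=> z _; exact: cvg_enormB.
Qed.

Lemma near_pair_enorm x (r : R) : 0 < r ->
  \forall p \near (x, x), enorm (p.1 - x) < r /\ enorm (p.2 - x) < r.
Proof.
move=> r0; have nA : nbhs x [set z | enorm (z - x) < r].
  by apply/near_enormP; exists r.
by exists ([set z | enorm (z - x) < r], [set z | enorm (z - x) < r]).
Qed.

End EuclideanSpace.

(** * Bregman distances and second-order bounds along segments *)

Section Calculus.
Context {R : realType} {n : nat}.
Implicit Types (U W : 'rV[R]_n -> R) (e u v w x y z : 'rV[R]_n) (a b t : R).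

Definition bregR U x y : R := U x - U y - dotp (grad U y) (x - y).

Definition hessq U z e : R := dotp (e *m hess U z) e.

Lemma derive_dotp U x e : differentiable U x -> 'D_e U x = dotp (grad U x) e.
Proof.
move=> dU; rewrite deriveE// {1}[e]row_sum_delta linear_sum.
by apply: eq_bigr => i _; rewrite linearZ mxE deriveE// mulrC.
Qed.

Lemma is_derive_line U v e t : differentiable U (v + t *: e) ->
  is_derive t 1 (fun s : R => U (v + s *: e)) (dotp (grad U (v + t *: e)) e).
Proof.
move=> dU; have dUe : derivable U (v + t *: e) e by exact: diff_derivable.
have qE : (fun h : R => h^-1 *: (((fun s : R => U (v + s *: e)) \o shift t)
              (h *: 1) - U (v + t *: e))) =
    (fun h : R => h^-1 *: ((U \o shift (v + t *: e)) (h *: e)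
              - U (v + t *: e))).
  apply/funext => h /=; congr (_ *: (U _ - _)).
  by rewrite [h%:A]mulr1 scalerDl addrCA.
by split; rewrite /derivable /derive qE// -derive_dotp.
Qed.

Lemma is_derive_grad_line U v e w t : differentiable (grad U) (v + t *: e) ->
  is_derive t 1 (fun s : R => dotp (grad U (v + s *: e)) w)
    (dotp w (e *m (hess U (v + t *: e))^T)).
Proof.
move=> dG.
have -> : (fun s : R => dotp (grad U (v + s *: e)) w) =
    \sum_(i < n) (w 0 i \*: fun s : R => grad U (v + s *: e) 0 i).
  by apply/funext => s; rewrite fct_sumE; apply: eq_bigr => i _; rewrite mulrC.
have dGi i : is_derive t 1 (fun s : R => grad U (v + s *: e) 0 i)
    (dotp (grad (fun z => grad U z 0 i) (v + t *: e)) e).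
  apply: (@is_derive_line (fun z => grad U z 0 i)).
  apply: (@differentiable_comp _ _ _ _ (grad U) (fun M => M 0 i)) => //.
  exact: differentiable_coord.
apply: is_derive_eq; apply: eq_bigr => i _; congr (_ * _).
by rewrite mxE dotpC; apply: eq_bigr => j _; rewrite !mxE.
Qed.

(** Second-order Taylor bound.  On the segment from [v] to [v + e], the mean
    value theorem applied to the directional derivative shows that it grows at
    rate at least [a]; applied to [U] minus the parabola [a t^2 / 2], it then
    gives the claim.  Applied to [- U] with a negative [a], it bounds the Bregman
    distance of [U] from above. *)
Lemma bregR_ge U v e a :
  (forall z, differentiable U z) -> (forall z, differentiable (grad U) z) ->
  (forall t, 0 <= t <= 1 -> a <= hessq U (v + t *: e) e) ->
  a / 2 <= bregR U (v + e) v.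
Proof.
move=> dU dG qge.
pose psi t := dotp (grad U (v + t *: e)) e.
have dphi t : is_derive t 1 (fun s : R => U (v + s *: e)) (psi t).
  exact: is_derive_line.
have dpsi t : is_derive t 1 psi (hessq U (v + t *: e) e).
  apply: is_derive_eq; first exact: is_derive_grad_line.
  rewrite /hessq /dotp; under eq_bigr do rewrite mxE mulr_sumr.
  rewrite exchange_big; apply: eq_bigr => j _; rewrite [in RHS]mxE mulr_suml.
  by apply: eq_bigr => i _; rewrite [_^T j i]mxE mulrCA mulrC.
pose phi := (fun s : R => U (v + s *: e)) - (a / 2) \*: (id ^+ 2).
have [||c] := @MVT R phi (fun t => psi t - a * t) 0 1 ltr01.
- move=> t _; apply: is_derive_eq.
  by rewrite expr1 /= /GRing.scale/=; field.
- by apply: derivable_within_continuous => t _; apply: ex_derive.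
rewrite in_itv/= => /andP[c0 c1]; rewrite subr0 mulr1.
have [|s] := @MVT R psi (fun t => hessq U (v + t *: e) e) 0 c c0.
- by apply: derivable_within_continuous => t _; apply: ex_derive.
rewrite in_itv/= => /andP[s0 sc]; rewrite subr0 => psiE.
have as_ : a <= hessq U (v + s *: e) e.
  by apply: qge; rewrite ltW//= ltW// (lt_trans sc).
have phiE t : phi t = U (v + t *: e) - a / 2 * t ^+ 2.
  by rewrite /phi !fctE.
rewrite !phiE /bregR [v + e - v]addrC addKr scale1r scale0r addr0.
have : psi 0 = dotp (grad U v) e by rewrite /psi scale0r addr0.
by nra.
Qed.

End Calculus.

(** * Local bounds from the Hessian *)

Section Hessian.
Context {R : realType} {n : nat}.
Implicit Types (U W : 'rV[R]_n -> R) (e u v w x y z : 'rV[R]_n) (a b t : R).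

(** The gradient inequality: convexity bounds the difference quotients at [y]
    in the direction [x - y] by [U x - U y]. *)
Lemma convex_bregR_ge0 U x y : convex_function setT U -> differentiable U y ->
  0 <= bregR U x y.
Proof.
move=> cU dU; rewrite /bregR subr_ge0 -derive_dotp//.
have /cvg_dnbhs_at_right/cvgr_to_le : derivable U y (x - y).
  exact: diff_derivable.
apply; near=> t.
have t0 : 0 < t by near: t; exact: nbhs_right_gt.
have t1 : t < 1 by near: t; exact: nbhs_right_lt.
have t01 : 0 <= t <= 1 by rewrite !ltW.
have xyE : t *: (x - y) + y = t *: x + (1 - t) *: y.
  by apply/rowP => i; rewrite !mxE; ring.
have le_U : U (t *: x + (1 - t) *: y) <= t * U x + (1 - t) * U y :=
  cU (Itv01 (ltW t0) (ltW t1)) x y (in_setT _) (in_setT _).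
rewrite [_ *: _]mulrC ler_pdivrMr//.
rewrite /= xyE; lra.
Unshelve. all: by end_near. Qed.

Lemma cvg_hessq {T : Type} {F : set_system T} {FF : Filter F} U
    (zt et : T -> 'rV[R]_n) z e :
  continuous (hess U) -> zt @ F --> z -> et @ F --> e ->
  hessq U (zt t) (et t) @[t --> F] --> hessq U z e.
Proof.
move=> cU ztz ete.
have E z' e' : hessq U z' e' =
    \sum_j (\sum_i e' 0 i * hess U z' i j) * e' 0 j.
  by apply: eq_bigr => j _; rewrite mxE.
under eq_cvg do rewrite E.
rewrite E; apply: cvg_big => [|j _]; first exact: add_continuous.
apply: cvgM; last exact: cvg_coord.
apply: cvg_big => [|i _]; first exact: add_continuous.
apply: cvgM; first exact: cvg_coord.
have Hz : hess U (zt t) @[t --> F] --> hess U z.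
  exact: (continuous_cvg _ (cU z) ztz).
apply: (@cvg_comp _ _ _ (hess U \o zt) (fun M : 'M[R]_n => M i j) _ _ _ Hz).
exact: coord_continuous.
Qed.

Lemma compact_enorm_sphere : compact [set e : 'rV[R]_n | enorm e = 1].
Proof.
apply: (@subclosed_compact _ _ [set z | enorm (z - 0) <= 1]).
- have -> : [set e : 'rV[R]_n | enorm e = 1] =
      (fun z => enorm (z - 0)) @^-1` [set 1].
    by apply/seteqP; split=> z /=; rewrite subr0.
  apply: closed_comp; last exact: closed_eq.
  by move=> z _; exact: cvg_enormB.
- exact: compact_enorm_ball.
- by move=> e /=; rewrite subr0 => ->.
Qed.

(** A bound on the quadratic form at [x] persists near [x], uniformly over the
    directions, by compactness of the unit sphere.  The constant [a] runs along
    a filter: with [0^'+] the lemma produces a positive modulus from positive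
    definiteness, with [-oo] it produces some lower bound for any Hessian. *)
Lemma hessq_near_ge U x (G : set_system R) {FG : Filter G} :
  continuous (hess U) ->
  (forall e, enorm e = 1 ->
    exists2 b, b < hessq U x e & \forall a \near G, a <= b) ->
  \forall z \near x & a \near G, forall e, a * enorm e ^+ 2 <= hessq U z e.
Proof.
move=> cU eb.
have := (compact_near_coveringP _).1 compact_enorm_sphere
  ('rV[R]_n * R)%type (filter_prod (nbhs x) G)
  (fun p e => p.2 <= hessq U p.1 e) _ _.
have /[swap]/[apply] : forall e0 : 'rV[R]_n,
  [set e : 'rV[R]_n | enorm e = 1] e0 ->
  \forall e \near e0 & p \near filter_prod (nbhs x) G, p.2 <= hessq U p.1 e.
  move=> e0 /eb[b bx Gb].
  have qc : hessq U q.2 q.1 @[q --> (e0, x)] --> hessq U x e0.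
    by apply: cvg_hessq => //; [exact: cvg_snd|exact: cvg_fst].
  have [[A B] [/= nA nB] AB] := cvgr_gt _ qc _ bx.
  exists (A, [set p | B p.1 /\ p.2 <= b]).
    split=> //; exists (B, [set a | a <= b]) => // -[z a]/= [Bz ab]; by split.
  move=> [e [z a]]/= [Ae [Bz ab]]; apply: (le_trans ab); apply: ltW.
  by apply: (AB (e, z)).
apply: filterS => -[z a]/= ae e.
have [->|e0] := eqVneq e 0.
  by rewrite enorm0 expr0n mulr0 /hessq dotp0r.
have ne_gt0 : 0 < enorm e by rewrite lt_neqAle eq_sym enorm_eq0 e0 enorm_ge0.
have /ae : [set e : 'rV[R]_n | enorm e = 1] ((enorm e)^-1 *: e).
  by rewrite /= enormZ ger0_norm ?invr_ge0 ?enorm_ge0// mulVf ?gt_eqF.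
rewrite /hessq -scalemxAl dotpZl dotpZr mulrA -expr2 exprVn.
by rewrite ler_pdivlMl ?exprn_gt0// mulrC.
Qed.

Lemma posdef_near U x : continuous (hess U) -> posdef (hess U x) ->
  exists2 m : R, 0 < m &
    \forall z \near x, forall e, m * enorm e ^+ 2 <= hessq U z e.
Proof.
move=> cU pU; have [|[A B] [/= nA nB] AB] := @hessq_near_ge U x 0^'+ _ cU.
  move=> e e1; exists (hessq U x e / 2).
    by rewrite ltr_pdivrMr// ltr_pMr ?ltr1n// pU// -enorm_eq0 e1 oner_eq0.
  near=> a; near: a; apply: nbhs_right_le; rewrite divr_gt0// pU//.
  by rewrite -enorm_eq0 e1 oner_eq0.
have [m [m0 Bm]] : exists m, 0 < m /\ B m.
  near (0 : R)^'+ => m; exists m; split; first by near: m; exact: nbhs_right_gt.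
  by near: m.
by exists m => //; apply: filterS nA => z Az; apply: (AB (z, m)).
Unshelve. all: by end_near. Qed.

Lemma hessq_near_lower U x : continuous (hess U) ->
  exists m : R, \forall z \near x, forall e, m * enorm e ^+ 2 <= hessq U z e.
Proof.
move=> cU; have [|[A B] [/= nA nB] AB] := @hessq_near_ge U x -oo _ cU.
  move=> e e1; exists (hessq U x e - 1); first by rewrite gtrBl.
  exact/nbhs_ninfty_le/num_real.
have [m Bm] : exists m, B m by near (-oo : set_system R) => m; exists m; near: m.
by exists m; apply: filterS nA => z Az; apply: (AB (z, m)).
Unshelve. all: by end_near. Qed.

Lemma bregR_near_ge U x a : C2 U ->
  (\forall z \near x, forall e, a * enorm e ^+ 2 <= hessq U z e) ->
  exists2 r : R, 0 < r & forall u v, enorm (u - x) < r -> enorm (v - x) < r ->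
    a / 2 * enorm (u - v) ^+ 2 <= bregR U u v.
Proof.
move=> [dU dG _] /near_enormP[r r0 rP]; exists r => // u v ur vr.
rewrite mulrAC -{2}(subrKC v u); apply: bregR_ge => // t /andP[t0 t1].
apply: rP.
have -> : v + t *: (u - v) - x = t *: (u - x) + (1 - t) *: (v - x).
  by apply/rowP => i; rewrite !mxE; ring.
apply: le_lt_trans (enormD _ _) _.
rewrite !enormZ !ger0_norm ?subr_ge0//.
have [->|tN0] := eqVneq t 0; first by rewrite mul0r add0r subr0 mul1r.
have t_gt0 : 0 < t by rewrite lt_neqAle eq_sym tN0.
nra.
Qed.

Lemma posdef_bregR_near U x : C2 U -> posdef (hess U x) ->
  exists2 m : R, 0 < m & exists2 r : R, 0 < r &
    forall u v, enorm (u - x) < r -> enorm (v - x) < r ->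
      m * enorm (u - v) ^+ 2 <= bregR U u v.
Proof.
move=> U2 pU; have [_ _ cU] := U2.
have [m m0 /(bregR_near_ge U2) Ur] := posdef_near cU pU.
by exists (m / 2) => //; rewrite divr_gt0.
Qed.

Lemma C2_bregR_near U x : C2 U ->
  exists m : R, exists2 r : R, 0 < r &
    forall u v, enorm (u - x) < r -> enorm (v - x) < r ->
      m * enorm (u - v) ^+ 2 <= bregR U u v.
Proof.
move=> U2; have [_ _ cU] := U2.
have [m /(bregR_near_ge U2) Ur] := hessq_near_lower x cU.
by exists (m / 2).
Qed.

Lemma bregR_ge0 U x y : C2 U -> (forall z, posdef (hess U z)) ->
  0 <= bregR U x y.
Proof.
move=> [dU dG _] pU; rewrite -(mul0r 2^-1) -(subrKC y x).
apply: bregR_ge => // t _.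
have [->|e0] := eqVneq (x - y) 0; first by rewrite /hessq dotp0r.
by apply: ltW; exact: pU.
Qed.

(** Along a ray from [x], the map [e |-> bregR U (x + e) x] is convex and
    vanishes at [0], hence grows at least linearly with the dilation factor.  In
    terms of Bregman distances, the inequality is a combination of the
    nonnegativity of those from [x + e] to [x + s *: e] and to [x]. *)
Lemma bregR_scale_ge U x e s : (forall u v, 0 <= bregR U u v) -> 1 <= s ->
  s * bregR U (x + e) x <= bregR U (x + s *: e) x.
Proof.
move=> U0 s1; have := U0 (x + s *: e) (x + e); have := U0 x (x + e).
rewrite /bregR.
have -> : x + s *: e - (x + e) = (s - 1) *: e.
  by apply/rowP => i; rewrite !mxE; ring.
have -> : x - (x + e) = - e by rewrite opprD addrA subrr add0r.
rewrite ![x + _ - x]addrC !addKr !dotpZr dotpNr => U1 U2.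
have s1' : 0 <= s - 1 by rewrite subr_ge0.
have := mulr_ge0 s1' U1; move: U2.
move: (U (x + s *: e)) (U (x + e)) (U x) (dotp _ _) (dotp _ _) => a b c d f.
by lra.
Qed.

Lemma grad_comb U W a b z : differentiable U z -> differentiable W z ->
  grad (fun y => a * U y + b * W y) z = a *: grad U z + b *: grad W z.
Proof.
move=> dU dW; apply/rowP => i; rewrite !mxE.
have dUi : derivable U z (delta_mx 0 i) by exact: diff_derivable.
have dWi : derivable W z (delta_mx 0 i) by exact: diff_derivable.
have daU : derivable (a \*: U) z (delta_mx 0 i) by exact: derivableZ.
have dbW : derivable (b \*: W) z (delta_mx 0 i) by exact: derivableZ.
by rewrite (deriveD daU dbW) (deriveZ a dUi) (deriveZ b dWi).
Qed.

Lemma C2_comb U W a b : C2 U -> C2 W -> C2 (fun z => a * U z + b * W z).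
Proof.
move=> [dU gU hU] [dW gW hW].
have gE : grad (fun z => a * U z + b * W z) = a \*: grad U + b \*: grad W.
  by apply/funext => z; rewrite grad_comb.
split=> [z|z|].
- by apply: (@differentiableD _ _ _ (a \*: U) (b \*: W)) => //;
    exact: differentiableZ.
- by rewrite gE; apply: differentiableD => //; exact: differentiableZ.
- have -> : hess (fun z => a * U z + b * W z) = a \*: hess U + b \*: hess W.
    apply/funext => z; apply/matrixP => i j.
    transitivity ((a *: hess U z + b *: hess W z) i j) => //.
    rewrite [LHS]mxE [RHS]mxE [X in _ = X + _]mxE [X in _ = _ + X]mxE.
    rewrite [X in _ = _ * X + _]mxE [X in _ = _ + _ * X]mxE gE.
    have -> : (fun y => (a \*: grad U + b \*: grad W) y 0 i) =
      a \*: (fun y => grad U y 0 i) + b \*: (fun y => grad W y 0 i).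
      apply/funext => y.
      transitivity ((a *: grad U y + b *: grad W y) 0 i) => //.
      by rewrite mxE [X in X + _]mxE [X in _ + X]mxE.
    have dg (V : 'rV[R]_n -> R) : differentiable (grad V) z ->
        derivable (fun y => grad V y 0 i) z (delta_mx 0 j).
      move=> dV; apply: diff_derivable.
      apply: (@differentiable_comp _ _ _ _ (grad V) (fun M => M 0 i)) => //.
      exact: differentiable_coord.
    have dUij := dg U (gU z); have dWij := dg W (gW z).
    rewrite (deriveD (derivableZ (k := a) dUij) (derivableZ (k := b) dWij)).
    by rewrite (deriveZ a dUij) (deriveZ b dWij).
  move=> z; have Fz := @nbhs_filter _ z.
  exact: (cvgD (cvgZl_tmp (hU z)) (cvgZl_tmp (hW z))).
Qed.

Lemma bregR_comb U W a b x y : differentiable U y -> differentiable W y ->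
  bregR (fun z => a * U z + b * W z) x y = a * bregR U x y + b * bregR W x y.
Proof. by move=> dU dW; rewrite /bregR grad_comb// dotpDl !dotpZl; ring. Qed.

Lemma bregR_sqr a x y :
  bregR (fun z => a * enorm z ^+ 2) x y = a * enorm (x - y) ^+ 2.
Proof.
have sqE z : (\sum_i (fun z : 'rV[R]_n => z 0 i) ^+ 2) z = enorm z ^+ 2.
  by rewrite fct_sumE sqr_enorm; apply: eq_bigr => i _; rewrite fctE expr2.
have -> : (fun z : 'rV[R]_n => a * enorm z ^+ 2) =
    a \*: (\sum_i (fun z => z 0 i) ^+ 2).
  by apply/funext => z; rewrite -sqE.
have dc i v z : is_derive z v (fun z : 'rV[R]_n => z 0 i) (v 0 i).
  split; first exact/diff_derivable/differentiable_coord.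
  apply: cvg_lim => //; apply: cvg_near_cst.
  near=> h; rewrite /= !mxE addrK [_ *: _]mulrA mulVf ?mul1r//.
  by near: h; exact: nbhs_dnbhs_neq.
have gE : grad (a \*: \sum_i (fun z : 'rV[R]_n => z 0 i) ^+ 2) y = (2 * a) *: y.
  apply/rowP => i; rewrite !mxE derive_val /= (bigD1 i)//= big1 ?addr0.
    by rewrite mxE !eqxx /GRing.scale/=; ring.
  by move=> j ji; rewrite mxE (negPf ji) andbF scaler0.
rewrite /bregR gE /= !sqE !sqr_enorm dotpZl !dotpBr !dotpBl (dotpC y x).
by rewrite /GRing.scale/=; ring.
Unshelve. all: by end_near. Qed.

End Hessian.

(** * The model as a real function *)

Section Model.
Context {R : realType} {n : nat}.
Variables (F H : 'rV[R]_n -> R) (g : 'rV[R]_n -> \bar R) (gamma beta : R).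
Hypotheses (F2 : C2 F) (H2 : C2 H) (gN : forall w, g w != -oo%E).
Implicit Types (e u v w x y z xm : 'rV[R]_n) (a b t r : R).

Let f := EFin \o F.
Let h := EFin \o H.

(** Both reference functions are written as combinations [a * U + b * W] so that
    the calculus of such combinations applies to them verbatim. *)
Definition hhatR := fun w => gamma^-1 * H w + (-1) * F w.
Definition fhatR := fun w => 1 * F w + (- (beta / gamma)) * H w.

Lemma hhatRE : hhat f h gamma = EFin \o hhatR.
Proof.
by apply/funext => w; rewrite /hhat /f /h /hhatR /= -EFinM -dEFinB mulN1r.
Qed.

Lemma fhatRE : fhat f h gamma beta = EFin \o fhatR.
Proof.
apply/funext => w; rewrite /fhat /f /h /fhatR /=.
by rewrite -dEFinD mul1r mulNr.
Qed.

Lemma breg_EFin (U : 'rV[R]_n -> R) x y :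
  breg (EFin \o U) x y = (bregR U x y)%:E.
Proof. by rewrite /breg -!dEFinB. Qed.

Let dF z : differentiable F z. Proof. by case: F2. Qed.
Let dH z : differentiable H z. Proof. by case: H2. Qed.

Lemma bregR_hhatR x y :
  bregR hhatR x y = gamma^-1 * bregR H x y - bregR F x y.
Proof. by rewrite bregR_comb// mulN1r. Qed.

Lemma bregR_fhatR x y :
  bregR fhatR x y = bregR F x y - beta / gamma * bregR H x y.
Proof. by rewrite bregR_comb// mul1r mulNr. Qed.

(** The finite part of the model: all of it except [g], which is the only
    function that may take infinite values. *)
Definition modelR x xm w : R :=
  F w + bregR hhatR w x + dotp (w - x) (grad fhatR x - grad fhatR xm).

Lemma modelRE x xm w :
  model f g h gamma beta x xm w = (g w + (modelR x xm w)%:E)%E.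
Proof.
rewrite /model /phi hhatRE fhatRE breg_EFin /f /= /modelR.
case: (g w) (gN w) => [s| |]// _; rewrite -!dEFinD -EFinD; congr _%:E.
by ring.
Qed.

Lemma modelR_diag x w : modelR x x w = F w + bregR hhatR w x.
Proof. by rewrite /modelR subrr dotp0r addr0. Qed.

Let C2_continuous (U : 'rV[R]_n -> R) : C2 U ->
  continuous U /\ continuous (grad U).
Proof.
by case=> dU gU _; split=> z; exact: differentiable_continuous.
Qed.

Lemma cvg_bregR {T : Type} {G : set_system T} {FG : Filter G}
    (U : 'rV[R]_n -> R) (u v : T -> 'rV[R]_n) x y :
  C2 U -> u @ G --> x -> v @ G --> y ->
  bregR U (u t) (v t) @[t --> G] --> bregR U x y.
Proof.
move=> /C2_continuous[cU cgU] ux vy; apply: cvgB; first apply: cvgB.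
- exact: (continuous_cvg _ (cU x) ux).
- exact: (continuous_cvg _ (cU y) vy).
- apply: cvg_dotp; first exact: (continuous_cvg _ (cgU y) vy).
  exact: (cvgB ux vy).
Qed.

Lemma cvg_modelR {T : Type} {G : set_system T} {FG : Filter G}
    (u v q : T -> 'rV[R]_n) x xm w :
  u @ G --> x -> v @ G --> xm -> q @ G --> w ->
  modelR (u t) (v t) (q t) @[t --> G] --> modelR x xm w.
Proof.
move=> ux vxm qw; apply: cvgD; first apply: cvgD.
- exact: (continuous_cvg _ ((C2_continuous F2).1 w) qw).
- exact: (cvg_bregR (C2_comb _ _ H2 F2) qw ux).
- have [_ cg] := C2_continuous (C2_comb 1 (- (beta / gamma)) F2 H2).
  apply: cvg_dotp; first exact: (cvgB qw ux).
  exact: (cvgB (continuous_cvg _ (cg x) ux) (continuous_cvg _ (cg xm) vxm)).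
Qed.

End Model.

(** * Localization of the minimizers of the model *)

(** Local strong convexity forces linear growth at infinity, uniformly in the
    base point: dilate the displacement of length [r / 4], for which the
    quadratic bound holds. *)
Lemma bregR_linear_growth (R : realType) (n : nat) (U : 'rV[R]_n -> R)
    (p x w : 'rV[R]_n) (m r : R) :
  0 < r -> (forall u v, 0 <= bregR U u v) ->
  (forall u v, enorm (u - p) < r -> enorm (v - p) < r ->
    m * enorm (u - v) ^+ 2 <= bregR U u v) ->
  enorm (x - p) < r / 2 -> r / 4 <= enorm (w - x) ->
  m * (r / 4) * enorm (w - x) <= bregR U w x.
Proof.
move=> r0 U0 Um xp wx; pose s := enorm (w - x) / (r / 4).
have r4 : 0 < r / 4 by lra.
have s1 : 1 <= s by rewrite ler_pdivlMr// mul1r.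
have s0 : s != 0 by rewrite gt_eqF// (lt_le_trans ltr01).
pose e := s^-1 *: (w - x).
have ne : enorm e = r / 4.
  rewrite enormZ ger0_norm ?invr_ge0 ?(le_trans ler01)// invf_div mulrAC.
  by rewrite -mulrA divff ?mulr1// gt_eqF// (lt_le_trans r4).
have wE : w = x + s *: e by rewrite scalerA divff// scale1r addrC subrK.
have := bregR_scale_ge x e U0 s1; rewrite -wE; apply: le_trans.
have xep : enorm (x + e - p) < r.
  rewrite addrAC (le_lt_trans (enormD _ _))// ne; lra.
have xp' : enorm (x - p) < r by lra.
have := Um _ _ xep xp'; rewrite [x + e]addrC addrK ne => Ue.
have -> : m * (r / 4) * enorm (w - x) = s * (m * (r / 4) ^+ 2).
  by rewrite /s; field; rewrite gt_eqF.
by rewrite ler_wpM2l// (le_trans ler01).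
Qed.

Section Localization.
Context {R : realType} {n : nat}.
Variables (F H : 'rV[R]_n -> R) (g : 'rV[R]_n -> \bar R) (gamma beta : R).
Hypotheses (F2 : C2 F) (H2 : C2 H) (gN : forall w, g w != -oo%E).
Hypothesis glsc : lower_semicontinuous g.
Variables (xs : 'rV[R]_n) (m0 k0 m r : R).
Let f := EFin \o F.
Let h := EFin \o H.
Hypothesis phi_ge : forall w, (m0%:E <= g w + (F w)%:E)%E.
Hypotheses (k0_gt0 : 0 < k0) (m_gt0 : 0 < m) (r_gt0 : 0 < r).
Hypothesis H_ge0 : forall u v, 0 <= bregR H u v.
Hypothesis hhat_ge : forall u v, k0 * bregR H u v <= bregR (hhatR F H gamma) u v.
Hypothesis H_ge : forall u v, enorm (u - xs) < r -> enorm (v - xs) < r ->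
    m * enorm (u - v) ^+ 2 <= bregR H u v.
Hypothesis gxs : (g xs < +oo)%E.
Hypothesis Txs : T_op f g h gamma beta xs xs = [set xs].

Let M := modelR F H gamma beta.

Let modelE x xm w :
  model f g h gamma beta x xm w = (g w + (M x xm w)%:E)%E.
Proof. exact: modelRE. Qed.

Let gfin : g xs = (fine (g xs))%:E.
Proof. by rewrite fineK// fin_numE gN -ltey. Qed.

(** In the model at [(x, x')], the distance [D_hhat(w, x)] grows linearly in
    [|w - x|] with a fixed slope [eta], while the perturbation
    [<w - x, grad fhat x - grad fhat x'>] has slope tending to 0 and [phi] is
    bounded below.  Since the optimal value stays below [phi xs + 1], minimizers
    stay bounded. *)
Lemma near_argmin_bounded : exists B : R,
  \forall p \near (xs, xs), forall w, T_op f g h gamma beta p.1 p.2 w ->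
    enorm (w - xs) <= B.
Proof.
pose eta := k0 * (m * (r / 4)).
have eta0 : 0 < eta by rewrite !mulr_gt0.
pose B := 2 / eta * (fine (g xs) + F xs + 1 - m0).
exists (Num.max (r / 4) B + r / 2).
have M_near : \forall p \near (xs, xs), M p.1 p.2 xs < F xs + 1.
  have MF : M xs xs xs = F xs.
    by rewrite /M modelR_diag /bregR !subrr dotp0r subr0 addr0.
  have Mc : M p.1 p.2 xs @[p --> (xs, xs)] --> M xs xs xs.
    by apply: cvg_modelR => //; [exact: cvg_fst|exact: cvg_snd|exact: cvg_cst].
  by apply: (cvgr_lt _ Mc); rewrite MF ltrDl.
have grad_near : \forall p \near (xs, xs),
    enorm (grad (fhatR F H gamma beta) p.1 - grad (fhatR F H gamma beta) p.2)
      < eta / 2.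
  have cG : {for xs, continuous (grad (fhatR F H gamma beta))}.
    have [_ dG _] := C2_comb 1 (- (beta / gamma)) F2 H2.
    exact: differentiable_continuous.
  have Gc : (grad (fhatR F H gamma beta) p.1 - grad (fhatR F H gamma beta) p.2)
      @[p --> (xs, xs)] --> grad (fhatR F H gamma beta) xs
        - grad (fhatR F H gamma beta) xs.
    apply: cvgB; apply: (continuous_cvg _ cG); [exact: cvg_fst|exact: cvg_snd].
  have nGc := cvg_enorm Gc; rewrite subrr enorm0 in nGc.
  have e2 : 0 < eta / 2 by rewrite divr_gt0.
  exact: (cvgr_lt _ (nGc _) _ e2).
near=> p => w Tw.
have Mp : M p.1 p.2 xs < F xs + 1 by near: p.
have Gp : enorm (grad (fhatR F H gamma beta) p.1 -
    grad (fhatR F H gamma beta) p.2) < eta / 2 by near: p.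
have [xp _] : enorm (p.1 - xs) < r / 2 /\ enorm (p.2 - xs) < r / 2.
  by near: p; apply: near_pair_enorm; rewrite divr_gt0.
rewrite (le_trans (enorm_triangle p.1 _ _))// lerD ?(ltW xp)// le_max.
have [//|wx/=] := leP (enorm (w - p.1)) (r / 4).
have := Tw xs; rewrite !modelE gfin -EFinD.
have := phi_ge w; case: (g w) => [s| |]//; rewrite -!EFinD !lee_fin => ms sM.
have := bregR_linear_growth r_gt0 H_ge0 H_ge xp (ltW wx).
have := hhat_ge w p.1.
have := dotp_le (p.1 - w) (grad (fhatR F H gamma beta) p.1 -
  grad (fhatR F H gamma beta) p.2).
rewrite -opprB dotpNl enormN => le_dot le_hhat le_H.
have le_dot' : enorm (w - p.1) * enorm (grad (fhatR F H gamma beta) p.1 -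
    grad (fhatR F H gamma beta) p.2) <= enorm (w - p.1) * (eta / 2).
  by rewrite ler_wpM2l ?enorm_ge0// ltW.
have le_H' := ler_wpM2l (ltW k0_gt0) le_H.
rewrite /B -ler_pdivrMl ?divr_gt0// invf_div.
move: sM Mp; rewrite /M /modelR.
by rewrite !mulrA -/eta in le_H'; rewrite /eta in le_dot' *; lra.
Unshelve. all: by end_near. Qed.

(** Outer semicontinuity of the argmin at [(xs, xs)].  Every [w0] in the compact
    shell left open by [near_argmin_bounded] is strictly worse than [xs] for the
    model at [(xs, xs)]; by lower semicontinuity of [g] this remains true for
    nearby [w] and nearby models, and a finite cover of the shell concludes. *)
Lemma near_argmin (rho : R) : 0 < rho ->
  \forall p \near (xs, xs), forall w, T_op f g h gamma beta p.1 p.2 w ->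
    enorm (w - xs) < rho.
Proof.
move=> rho0; have [B near_B] := near_argmin_bounded.
pose A : set 'rV[R]_n :=
  [set w | enorm (w - xs) <= B] `&` [set w | rho <= enorm (w - xs)].
have cA : compact A.
  apply: compact_closedI; first exact: compact_enorm_ball.
  have -> : [set w | rho <= enorm (w - xs)] =
    (fun w => enorm (w - xs)) @^-1` [set t | rho <= t] by [].
  apply: closed_comp; last exact: closed_ge.
  by move=> z _; exact: cvg_enormB.
pose P (p : 'rV[R]_n * 'rV[R]_n) w :=
  (model f g h gamma beta p.1 p.2 xs < model f g h gamma beta p.1 p.2 w)%E.
have P_near (w0 : 'rV[R]_n) : A w0 ->
    \forall w \near w0 & p \near nbhs (xs, xs), P p w.
  move=> [_ /= w0rho].
  have : (model f g h gamma beta xs xs xs < model f g h gamma beta xs xs w0)%E.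
    rewrite ltNge; apply/negP => le_w0.
    have Tx : T_op f g h gamma beta xs xs xs by rewrite Txs.
    have : T_op f g h gamma beta xs xs w0 by move=> z; exact: le_trans (Tx z).
    by rewrite Txs => /= w0E; move: w0rho; rewrite w0E subrr enorm0 leNgt rho0.
  rewrite !modelE gfin => lt_w0.
  pose a := fine (g xs) + M xs xs xs - M xs xs w0.
  (* A real threshold strictly between [a] and [g w0], which may be [+oo]. *)
  have [a' aa' a'g] : exists2 a', a < a' & (a'%:E < g w0)%E.
    move: lt_w0; case: (g w0) (gN w0) => [t| |]// _.
      rewrite -!EFinD lte_fin => lt_t; exists ((a + t) / 2).
        by rewrite /a; lra.
      by rewrite lte_fin /a; lra.
    by move=> _; exists (a + 1); rewrite ?ltrDl// ltry.
  have [V nV Vg] := glsc a'g.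
  have Mc : fine (g xs) + M q.2.1 q.2.2 xs - M q.2.1 q.2.2 q.1
      @[q --> (w0, (xs, xs))] --> a.
    have c2 : q.2 @[q --> (w0, (xs, xs))] --> (xs, xs) by exact: cvg_snd.
    have c21 : q.2.1 @[q --> (w0, (xs, xs))] --> xs.
      by apply: (cvg_comp _ _ c2); exact: cvg_fst.
    have c22 : q.2.2 @[q --> (w0, (xs, xs))] --> xs.
      by apply: (cvg_comp _ _ c2); exact: cvg_snd.
    have c1 : q.1 @[q --> (w0, (xs, xs))] --> w0 by exact: cvg_fst.
    apply: cvgB; last exact: cvg_modelR.
    apply: cvgD; first exact: cvg_cst.
    by apply: cvg_modelR => //; exact: cvg_cst.
  have V_near : \forall q \near (w0, (xs, xs)), V q.1.
    by exists (V, setT); [split=> //; exact: filterT|move=> q []].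
  have a_near := cvgr_lt _ Mc _ aa'.
  suff : \forall q \near (w0, (xs, xs)), P q.2 q.1 by [].
  near=> q; have /Vg : V q.1 by near: q; exact: V_near.
  have : fine (g xs) + M q.2.1 q.2.2 xs - M q.2.1 q.2.2 q.1 < a'.
    by near: q; exact: a_near.
  rewrite /P !modelE gfin -EFinD.
  move: (M q.2.1 q.2.2 xs) (M q.2.1 q.2.2 q.1) (g q.1) => b d [t| |] //=.
  - by rewrite -EFinD !lte_fin; lra.
  - by move=> _ _; rewrite ltry.
have := (compact_near_coveringP _).1 cA _ _ P (nbhs_filter (xs, xs)) P_near.
apply: filterS2 near_B => p pB AP w Tw.
rewrite ltNge; apply/negP => rhow.
have : P p w by apply: AP; split=> //=; exact: pB.
by rewrite /P ltNge (Tw xs).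
Unshelve. all: by end_near. Qed.

End Localization.

(** * Consequences of admissibility *)

Lemma differentiable_sqr_enorm (R : realType) (n : nat) (a : R) (z : 'rV[R]_n) :
  differentiable (fun z : 'rV[R]_n => a * enorm z ^+ 2) z.
Proof.
have -> : (fun z : 'rV[R]_n => a * enorm z ^+ 2) =
    a \*: (\sum_(i < n) (fun z : 'rV[R]_n => z 0 i) ^+ 2).
  apply/funext => y; rewrite sqr_enorm /= /GRing.scale/=; congr (_ * _).
  by rewrite fct_sumE; apply: eq_bigr => i _; rewrite fctE expr2.
apply: differentiableZ; apply: differentiable_sum => i.
by apply: differentiableX; exact: differentiable_coord.
Qed.

Lemma strongly_convex_bregR (R : realType) (n : nat) (U : 'rV[R]_n -> R)
    (s : R) (x y : 'rV[R]_n) :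
  (forall z, differentiable U z) -> strongly_convex s (EFin \o U) ->
  s / 2 * enorm (x - y) ^+ 2 <= bregR U x y.
Proof.
move=> dU [_ cU].
have domT : edom (EFin \o U) = setT by apply/seteqP; split=> z _ //=; exact: ltry.
have UE : (fun z => fine ((EFin \o U) z) - s / 2 * enorm z ^+ 2) =
    (fun z => 1 * U z + (-1) * (s / 2 * enorm z ^+ 2)).
  by apply/funext => z /=; rewrite mul1r mulN1r.
rewrite domT UE in cU.
have dsq := differentiable_sqr_enorm (s / 2) y.
have dUs : differentiable (fun z => 1 * U z + (-1) * (s / 2 * enorm z ^+ 2)) y.
  apply: (@differentiableD _ _ _ (1 \*: U)
    (-1 \*: (fun z : 'rV[R]_n => s / 2 * enorm z ^+ 2)));
    by apply: differentiableZ.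
have := convex_bregR_ge0 x cU dUs.
by rewrite bregR_comb// bregR_sqr; lra.
Qed.

Lemma sigma_shift_gt0 (R : realType) (gamma s L sigma : R) :
  0 < gamma -> 0 < s -> 0 <= L ->
  0 < (1 + gamma * sigma) * s - 2 * gamma * L -> 0 < gamma^-1 + sigma.
Proof.
move=> g0 s0 L0 c0.
have -> : gamma^-1 + sigma = gamma^-1 * (1 + gamma * sigma).
  by rewrite mulrDr mulr1 mulrA mulVf ?mul1r// gt_eqF.
rewrite mulr_gt0 ?invr_gt0//.
have : 0 < (1 + gamma * sigma) * s.
  by have := mulr_ge0 (ltW g0) L0; lra.
by rewrite pmulr_lgt0.
Qed.

Section Admissible.
Context {R : realType} {n : nat}.
Variables (F H : 'rV[R]_n -> R) (gamma beta sf smf c : R).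
Variable (xi : 'rV[R]_n -> \bar R).
Let f := EFin \o F.
Let h := EFin \o H.
Hypotheses (F2 : C2 F) (H2 : C2 H) (H_ge0 : forall u v, 0 <= bregR H u v).
Hypothesis Hconst : relative_constants setT f h sf smf.
Hypothesis Hadm : admissible setT f h gamma beta sf smf c xi.
Implicit Types (u v w x y z xm : 'rV[R]_n).

Let dF z : differentiable F z. Proof. by case: F2. Qed.
Let dH z : differentiable H z. Proof. by case: H2. Qed.

Lemma alpha_p_mfh : gamma * L_fh sf smf * p_mfh sf smf = gamma * smf.
Proof.
case: Hconst => _ _ L0; rewrite /p_mfh -mulrA; congr (_ * _).
by rewrite mulrC -mulrA mulVf ?mulr1// gt_eqF.
Qed.

Lemma bregR_smooth x y : bregR F x y <= - (smf * bregR H x y).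
Proof.
case: Hconst => _ cU _.
have UE : (fun z => - fine (f z) - smf * fine (h z)) =
    (fun z => (-1) * F z + (- smf) * H z).
  by apply/funext => z /=; rewrite mulN1r mulNr.
rewrite UE in cU.
have [dU _ _] := C2_comb (-1) (- smf) F2 H2.
by have := convex_bregR_ge0 x cU (dU y); rewrite bregR_comb//; lra.
Qed.

Lemma admissible_c_gamma : 0 < c / (2 * gamma).
Proof.
case: Hadm => g0 [[_ _ _ _ c0]|[L [s [_ _ _ _ c0]]]];
  by rewrite divr_gt0// mulr_gt0.
Qed.

Lemma breg_xi x y : breg xi x y = (bregR (fine \o xi) x y)%:E.
Proof.
by case: Hadm => _ [[_ _ -> _ _]|[L [s [_ _ -> _ _]]]];
  rewrite ?fhatRE breg_EFin.
Qed.

(** [hhat - k0 h] is convex.  Relative smoothness gives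
    [D_hhat >= (1 / gamma + sigma_{-f,h}) D_h].  Under (B) this factor is
    positive; under (A), convexity of [fhat] gives
    [(beta / gamma + sigma_{-f,h}) D_h <= 0], so that the factor can be traded for
    [c / gamma] in front of [D_h]. *)
Lemma hhat_relatively_convex : exists2 k0 : R, 0 < k0 &
  forall u v, k0 * bregR H u v <= bregR (hhatR F H gamma) u v.
Proof.
case: Hadm => g0; rewrite alpha_p_mfh.
have ig0 : 0 < gamma^-1 by rewrite invr_gt0.
have gig : gamma^-1 * gamma = 1 by rewrite mulVf ?gt_eqF.
case=> [[cU _ _ cE c0]|[L [s [[L0 _] [s0 _] _ cE c0]]]].
- exists (c / gamma); first by rewrite divr_gt0.
  rewrite fhatRE in cU.
  have [dU _ _] := C2_comb 1 (- (beta / gamma)) F2 H2.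
  move=> u v; have := convex_bregR_ge0 u cU (dU v).
  rewrite bregR_fhatR// bregR_hhatR//; have := bregR_smooth u v.
  have := H_ge0 u v; move: (bregR H u v) (bregR F u v) => BH BF BH0 le_s le_f.
  have -> : c / gamma * BH = gamma^-1 * BH + 2 * (beta / gamma * BH)
      + 3 * (gamma^-1 * gamma) * (smf * BH) by rewrite cE; field; rewrite gt_eqF.
  rewrite gig; lra.
- exists (gamma^-1 + smf).
    by apply: (sigma_shift_gt0 g0 s0 L0); rewrite -cE.
  move=> u v; rewrite bregR_hhatR//; have := bregR_smooth u v; lra.
Qed.

(** The common lower bound under the two forms of admissibility.  Under (A) the
    three-point identity turns the inner product of the model and
    [D_xi = D_fhat(x, xm)] into [D_fhat(w, xm) - D_fhat(w, x)], whose first term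
    is nonnegative; what remains of [D_hhat - D_fhat] dominates
    [c / (2 gamma) D_h].  Under (B) the inner product is absorbed by
    [L / 2 |x - xm|^2] and [L / 2 |w - x|^2] through Young's inequality. *)
Lemma admissible_merit_ge xs (m r : R) : 0 < m ->
  (forall u v, enorm (u - xs) < r -> enorm (v - xs) < r ->
    m * enorm (u - v) ^+ 2 <= bregR H u v) ->
  exists2 k1 : R, 0 < k1 &
    forall x xm w, enorm (x - xs) < r -> enorm (w - xs) < r ->
      F w + k1 * enorm (w - x) ^+ 2 <=
        modelR F H gamma beta x xm w + bregR (fine \o xi) x xm.
Proof.
move=> m0 Hm; case: Hadm => g0; rewrite alpha_p_mfh.
have ig0 : 0 < gamma^-1 by rewrite invr_gt0.
have gig : gamma^-1 * gamma = 1 by rewrite mulVf ?gt_eqF.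
case=> [[cU _ xiE cE c0]|[L [s [[L0 lipU] [s0 scH] xiE cE c0]]]].
- exists (c / gamma / 2 * m); first by rewrite !mulr_gt0.
  rewrite xiE; rewrite fhatRE in cU *.
  rewrite -[fine \o _]/(fhatR F H gamma beta).
  have [dU _ _] := C2_comb 1 (- (beta / gamma)) F2 H2.
  move=> x xm w xr wr.
  have three : modelR F H gamma beta x xm w + bregR (fhatR F H gamma beta) x xm
      = F w + bregR (hhatR F H gamma) w x - bregR (fhatR F H gamma beta) w x
        + bregR (fhatR F H gamma beta) w xm.
    rewrite /modelR; move: (bregR (hhatR _ _ _) w x) => B.
    rewrite /bregR; move: (fhatR F H gamma beta) => U.
    rewrite (dotpC (w - x)) !dotpBl !dotpBr; ring.
  rewrite three.
  have := convex_bregR_ge0 w cU (dU xm).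
  have := convex_bregR_ge0 w cU (dU x).
  move: (bregR (fhatR F H gamma beta) w xm) => B0.
  rewrite bregR_fhatR// bregR_hhatR//; have := bregR_smooth w x.
  have := Hm _ _ wr xr; have := H_ge0 w x.
  move: (bregR H w x) (bregR F w x) (F w) (enorm (w - x) ^+ 2) => BH BF Fw N.
  move=> BH0 mN le_s le_f B00.
  have le_c : c / gamma / 2 * m * N <= c / gamma / 2 * BH.
    by rewrite -mulrA ler_wpM2l// !mulr_ge0// ltW.
  have c_ge0 : 0 <= c / gamma * BH by rewrite !mulr_ge0// ltW.
  have cBE : c / gamma * BH = gamma^-1 * BH + 2 * (beta / gamma * BH)
      + 3 * (gamma^-1 * gamma) * (smf * BH).
    by rewrite cE; field; rewrite gt_eqF.
  rewrite gig in cBE; lra.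
- exists (c / gamma / 2); first by rewrite !mulr_gt0.
  rewrite xiE -[fine \o _]/(fun z : 'rV[R]_n => L / 2 * enorm z ^+ 2).
  move=> x xm w xr wr; rewrite bregR_sqr /modelR bregR_hhatR//.
  have := bregR_smooth w x.
  have := strongly_convex_bregR w x dH scH.
  have := lipU x xm I I; rewrite fhatRE.
  rewrite -[egrad _ x]/(grad (fhatR F H gamma beta) x).
  rewrite -[egrad _ xm]/(grad (fhatR F H gamma beta) xm).
  have := dotp_le (x - w) (grad (fhatR F H gamma beta) x -
    grad (fhatR F H gamma beta) xm).
  rewrite -opprB dotpNl enormN.
  move: (grad (fhatR F H gamma beta) x - _) => G.
  move: (dotp _ _) (enorm G) => D NG.
  move: (bregR H w x) (bregR F w x) (F w) => BH BF Fw le_D le_G le_BH le_BF.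
  have := enorm_ge0 (w - x); have := enorm_ge0 (x - xm).
  move: (enorm (x - xm)) (enorm (w - x)) le_D le_G le_BH.
  move=> a b le_D le_G le_BH a0 b0.
  have le_D2 : - D <= L / 2 * (a ^+ 2 + b ^+ 2).
    have : b * NG <= b * (L * a) by rewrite ler_wpM2l.
    have : 0 <= L * (a - b) ^+ 2 by rewrite mulr_ge0// sqr_ge0.
    lra.
  have s_gt0 : 0 < gamma^-1 + smf.
    by apply: (sigma_shift_gt0 g0 s0 L0); rewrite -cE.
  have := ler_wpM2l (ltW s_gt0) le_BH.
  have -> : (gamma^-1 + smf) * (s / 2 * b ^+ 2) =
    (c / gamma / 2 + L) * b ^+ 2 by rewrite cE; field; rewrite gt_eqF.
  have : 0 <= L * b ^+ 2 by rewrite mulr_ge0// sqr_ge0.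
  lra.
Qed.

End Admissible.

(** * Bounds on the Lyapunov function *)

Section Lyapunov.
Context {R : realType} {n : nat}.
Variables (F H : 'rV[R]_n -> R) (g : 'rV[R]_n -> \bar R).
Variables (gamma beta sf smf c : R) (xi : 'rV[R]_n -> \bar R) (xs : 'rV[R]_n).
Let f := EFin \o F.
Let h := EFin \o H.
Hypotheses (F2 : C2 F) (H2 : C2 H) (pH : forall z, posdef (hess H z)).
Hypotheses (gN : forall w, g w != -oo%E) (glsc : lower_semicontinuous g).
Hypothesis Hconst : relative_constants setT f h sf smf.
Hypothesis Hadm : admissible setT f h gamma beta sf smf c xi.
Hypothesis phi_bounded : exists m0 : R, forall w, (m0%:E <= g w + (F w)%:E)%E.
Hypothesis Hmin : strong_local_min (phi f g) xs.
Hypothesis Txs : T_op f g h gamma beta xs xs = [set xs].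
Implicit Types (u v w x y z xm : 'rV[R]_n).

Lemma phiE w : phi f g w = (g w + (F w)%:E)%E.
Proof.
rewrite /phi /f /=; case: (g w) (gN w) => [s| |]// _.
by rewrite -dEFinD -EFinD addrC.
Qed.

Let gxs : (g xs < +oo)%E.
Proof.
have [+ _] := Hmin; rewrite /edom/= phiE.
by case: (g xs) => [s _| |]//; exact: ltry.
Qed.

Let gfin : g xs = (fine (g xs))%:E.
Proof. by rewrite fineK// fin_numE gN -ltey. Qed.

Let phis := fine (g xs) + F xs.

Let modelE x xm w : model f g h gamma beta x xm w =
  (g w + (modelR F H gamma beta x xm w)%:E)%E.
Proof. exact: modelRE. Qed.

Let H_ge0 u v : 0 <= bregR H u v.
Proof. exact: bregR_ge0. Qed.

Lemma envelope_argmin x xm w : T_op f g h gamma beta x xm w ->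
  envelope f g h gamma beta x xm = model f g h gamma beta x xm w.
Proof.
move=> Tw; apply/eqP; rewrite eq_le ereal_inf_lbound /=; last by exists w.
by apply/ereal_infP => _ [z _ <-]; exact: Tw.
Qed.

(** On the diagonal the Bregman terms of the Lyapunov function vanish, and [xs]
    is a competitor in the infimum that defines the envelope. *)
Lemma lyapunov_diag_le : exists2 K : R, 0 <= K &
  \forall z \near xs,
    (lyapunov f g h gamma beta c xi z z <=
     (phis + K * enorm (z - xs) ^+ 2)%:E)%E.
Proof.
have hhat2 : C2 (fun w => 1 * F w + (- gamma^-1) * H w) by exact: C2_comb.
have [a [r r0 ra]] := C2_bregR_near xs hhat2.
exists `|a| => //; apply/near_enormP; exists r => // z zr.
have xs_r : enorm (xs - xs) < r by rewrite subrr enorm0.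
rewrite /lyapunov /h !breg_EFin (breg_xi Hadm).
have b0 (U : 'rV[R]_n -> R) : bregR U z z = 0.
  by rewrite /bregR !subrr dotp0r subr0.
rewrite !b0 mule0 !dadde0.
apply: (@le_trans _ _ (model f g h gamma beta z z xs)).
  by apply: ereal_inf_lbound; exists xs.
rewrite modelE modelR_diag gfin -EFinD lee_fin addrA lerD2l bregR_hhatR//;
  try by [case: F2|case: H2].
have := ra _ _ xs_r zr; rewrite bregR_comb; [|by case: F2|by case: H2].
rewrite enorm_distC; have := sqr_ge0 (enorm (z - xs)).
have := ler_norm (- a); rewrite normrN => le_a N0 le_r.
have := ler_wpM2r N0 le_a; lra.
Qed.

(** For a minimizer [w] of the model at [(x, x')], the lower bound of
    [admissible_merit_ge] controls [|w - x|], the term in [D_h(x, x')] controls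
    [|x - x'|], quadratic growth of [phi] controls [|w - xs|], and
    [|x - xs|^2 <= 2 |w - x|^2 + 2 |w - xs|^2]. *)
Lemma lyapunov_near_ge : exists2 k : R, 0 < k &
  \forall p \near (xs, xs), forall w, T_op f g h gamma beta p.1 p.2 w ->
    ((phis + k * (enorm (p.1 - xs) ^+ 2 + enorm (p.1 - p.2) ^+ 2))%:E <=
     lyapunov f g h gamma beta c xi p.1 p.2)%E.
Proof.
have [m m_gt0 [r r_gt0 H_ge]] := posdef_bregR_near H2 (pH xs).
have [k1 k1_gt0 merit_ge] :=
  admissible_merit_ge F2 H2 H_ge0 Hconst Hadm m_gt0 H_ge.
have [k0 k0_gt0 hhat_ge] := hhat_relatively_convex F2 H2 H_ge0 Hconst Hadm.
have cg := admissible_c_gamma Hadm.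
have [m0 phi_ge] := phi_bounded.
case: Hmin => _ [mu mu_gt0 /near_enormP[rho rho_gt0 phi_growth]].
have rr_gt0 : 0 < Num.min rho r by rewrite lt_min rho_gt0.
have w_near := near_argmin F2 H2 gN glsc phi_ge k0_gt0 m_gt0 r_gt0 H_ge0
  hhat_ge H_ge gxs Txs rr_gt0.
pose k := Num.min (mu / 4) (Num.min (k1 / 2) (c / (2 * gamma) * m)).
have k_gt0 : 0 < k by rewrite !lt_min !divr_gt0//= mulr_gt0.
have [k_mu k_k1 k_c] : [/\ k <= mu / 4, k <= k1 / 2 & k <= c / (2 * gamma) * m].
  by split; rewrite /k !ge_min lexx ?orbT.
exists k => //.
near=> p => w Tw.
have [p1r p2r] : enorm (p.1 - xs) < r /\ enorm (p.2 - xs) < r.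
  by near: p; exact: near_pair_enorm.
have : enorm (w - xs) < Num.min rho r.
  by move: w Tw; near: p; exact: w_near.
rewrite lt_min => /andP[wrho wr].
rewrite /lyapunov (envelope_argmin Tw) modelE /h (breg_xi Hadm) !breg_EFin.
have := phi_growth w wrho; rewrite !phiE gfin.
have := merit_ge p.1 p.2 w p1r wr.
have := H_ge p.1 p.2 p1r p2r.
have := enorm_triangle w p.1 xs; rewrite (enorm_distC p.1 w).
move: (enorm_ge0 (p.1 - xs)) (enorm_ge0 (w - xs)) (enorm_ge0 (w - p.1)).
move: (enorm (p.1 - xs)) (enorm (w - xs)) (enorm (w - p.1)) (enorm (p.1 - p.2)).
move: (modelR F H gamma beta p.1 p.2 w) (bregR H p.1 p.2)
  (bregR (fine \o xi) p.1 p.2).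
move=> Q B X a b d e a0 b0 d0 abd Be QX.
case: (g w) (gN w) => [s| |] _ //; last by move=> _; exact: leey.
rewrite -!EFinD -EFinM -!dEFinD !lee_fin => le_s.
have kb : k * b ^+ 2 <= mu / 4 * b ^+ 2 by rewrite ler_wpM2r// sqr_ge0.
have kd : k * d ^+ 2 <= k1 / 2 * d ^+ 2 by rewrite ler_wpM2r// sqr_ge0.
have ke : k * e ^+ 2 <= c / (2 * gamma) * m * e ^+ 2.
  by rewrite ler_wpM2r// sqr_ge0.
have cB : c / (2 * gamma) * m * e ^+ 2 <= c / (2 * gamma) * B.
  by rewrite -mulrA ler_wpM2l// ltW.
have a2 : k * a ^+ 2 <= k * (2 * b ^+ 2 + 2 * d ^+ 2).
  rewrite (ler_wpM2l (ltW k_gt0))//.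
  have : a ^+ 2 <= (d + b) ^+ 2 by rewrite lerXn2r ?nnegrE ?addr_ge0.
  by have := sqr_ge0 (b - d); lra.
rewrite /phis; lra.
Unshelve. all: by end_near. Qed.

End Lyapunov.

(** * Eventual unit steps *)

(** Where [u k = p] the quotient is small only if [v k = p] too, so that the
    bound holds at every late index. *)
Lemma superlinear_le (R : realType) (n : nat) (v u : nat -> 'rV[R]_n)
    (p : 'rV[R]_n) (e : R) : superlinear v u p -> 0 < e ->
  \forall k \near \oo, enorm (v k - p) <= e * enorm (u k - p).
Proof.
move=> vu e0.
have nA : nbhs (0 : \bar R)%E [set t | (t < e%:E)%E].
  by apply: open_ereal_lt'; rewrite lte_fin.
near=> k.
have : ((enorm (v k - p))%:E / (enorm (u k - p))%:E < e%:E)%E.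
  by near: k; exact: (vu _ nA).
have := enorm_ge0 (v k - p); have := enorm_ge0 (u k - p).
move: (enorm (v k - p)) (enorm (u k - p)) => a b b0 a0; rewrite inver.
have [->|bN0] := eqVneq b 0.
  rewrite mulr0; have [->//|aN0] := eqVneq a 0.
  by rewrite gt0_muley// lte_fin lt_neqAle eq_sym aN0.
have b_gt0 : 0 < b by rewrite lt_neqAle eq_sym bN0.
by rewrite -EFinM lte_fin ltr_pdivrMr// => /ltW.
Unshelve. all: by end_near. Qed.

Lemma near_cvg_enorm (R : realType) (n : nat) (u : nat -> 'rV[R]_n)
    (p : 'rV[R]_n) : u @ \oo --> p ->
  forall r : R, 0 < r -> \forall k \near \oo, enorm (u k - p) < r.
Proof.
move=> up r r0; have nA : nbhs p [set z | enorm (z - p) < r].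
  by apply/near_enormP; exists r.
exact: (up _ nA).
Qed.

Lemma cvg_enorm_dominated (R : realType) (n : nat) (v u : nat -> 'rV[R]_n)
    (p : 'rV[R]_n) : u @ \oo --> p ->
  (\forall k \near \oo, enorm (v k - p) <= enorm (u k - p)) -> v @ \oo --> p.
Proof.
move=> up vu A /near_enormP[r r0 rA].
suff : \forall k \near \oo, A (v k) by [].
near=> k.
apply: rA; apply: (@le_lt_trans _ _ (enorm (u k - p))); first by near: k.
by near: k; exact: near_cvg_enorm.
Unshelve. all: by end_near. Qed.

(** A point [y] that has covered at most half of the way from [x] to [z] is far
    from [p] when [z] is much closer to [p] than [x] is; hence so is any pair
    [(x', y)], in the sense that [x' - p] and [x' - y] cannot both be small. *)
Lemma short_step_far (R : realType) (n : nat) (p x z x' y : 'rV[R]_n)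
    (t e k K : R) :
  0 < t <= 1 / 2 -> y - p = (1 - t) *: (x - p) + t *: (z - p) ->
  enorm (z - p) <= e * enorm (x - p) ->
  0 < e -> e <= 1 / 4 -> 0 <= k -> 0 <= K -> K * e ^+ 2 <= k / 32 ->
  K * enorm (z - p) ^+ 2 <= k * (enorm (x' - p) ^+ 2 + enorm (x' - y) ^+ 2).
Proof.
move=> /andP[t0 t2] yE le_e e_gt0 e4 k0 K0 eK.
have t1 : 0 <= 1 - t by lra.
have le_y : (1 - t) * enorm (x - p) <=
    enorm (x' - p) + enorm (x' - y) + t * enorm (z - p).
  have := enorm_triangle x' y p; rewrite (enorm_distC _ x').
  have := enormD (y - p) (- (t *: (z - p))).
  rewrite {1}yE addrK enormN !enormZ (ger0_norm t1) (ger0_norm (ltW t0)).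
  lra.
move: (enorm_ge0 (x - p)) (enorm_ge0 (z - p))
  (enorm_ge0 (x' - p)) (enorm_ge0 (x' - y)) le_e le_y.
move: (enorm (x - p)) (enorm (z - p)) (enorm (x' - p)) (enorm (x' - y)).
move=> a b a1 b1 a0 b0 a10 b10 le_e le_y.
have ab : a / 4 <= a1 + b1.
  have : t * (a + b) <= 1 / 2 * (a + b) by rewrite ler_wpM2r// addr_ge0.
  have : e * a <= 1 / 4 * a by rewrite ler_wpM2r.
  lra.
have a2 : a ^+ 2 / 16 <= 2 * (a1 ^+ 2 + b1 ^+ 2).
  have a4 : (a / 4) ^+ 2 <= (a1 + b1) ^+ 2.
    by rewrite lerXn2r ?nnegrE ?addr_ge0// divr_ge0.
  have := sqr_ge0 (a1 - b1); lra.
have b2 : K * b ^+ 2 <= k / 32 * a ^+ 2.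
  apply: (@le_trans _ _ (K * (e * a) ^+ 2)).
    by rewrite ler_wpM2l// lerXn2r ?nnegrE ?mulr_ge0// ltW.
  by rewrite exprMn mulrA ler_wpM2r// sqr_ge0.
have := ler_wpM2l k0 a2; lra.
Qed.

Theorem theorem5p3 (R : realType) (n : nat) (f g h : 'rV[R]_n -> \bar R)
  (sf smf gamma beta c : R) (xi : 'rV[R]_n -> \bar R) (delta : R)
  (xm1 : 'rV[R]_n) (x xbar d y : nat -> 'rV[R]_n) (tau : nat -> R)
  (xs : 'rV[R]_n)
  (Hstanding : standing_assumptions setT f g h)
  (Hconst : relative_constants setT f h sf smf)
  (Hadm : admissible setT f h gamma beta sf smf c xi)
  (Hiter : ifrb_iterates setT f g h gamma beta c xi delta xm1 x xbar d y tau)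
  (Hf : C2 (fine \o f)) (Hh : C2 (fine \o h))
  (Hhess : forall z, posdef (hess (fine \o h) z))
  (Hcvg : x @ \oo --> xs)
  (Hmin : strong_local_min (phi f g) xs)
  (HT : T_op f g h gamma beta xs xs = [set xs])
  (Hd : superlinear_directions d x xs) :
  (\forall k \near \oo, tau k = 1 /\ x k.+1 = x k + d k) /\
  superlinear_rate x xs.
Proof.
case: Hstanding => [[_ [[hN _] _ _ _] _ hint _]].
move=> [[fN _] _ _ _ [fsub _]] [[gN _] glsc] Hinf _.
have [H hE] : exists H, h = EFin \o H.
  exists (fine \o h); apply/funext => z; rewrite /= fineK// fin_numE hN -ltey.
  by have /interior_subset : (edom h)° z by rewrite hint.
have [F fE] : exists F, f = EFin \o F.
  exists (fine \o f); apply/funext => z; rewrite /= fineK// fin_numE fN -ltey.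
  by apply: fsub; rewrite hE /edom/= ltry.
move: Hconst Hadm Hiter Hf Hh Hhess Hmin HT Hinf; rewrite fE hE.
move=> Hconst Hadm Hiter F2 H2 pH Hmin HT Hinf.
have phi_bounded : exists m0 : R, forall w, (m0%:E <= g w + (F w)%:E)%E.
  have lb w : (ereal_inf (range (phi_cl setT (EFin \o F) g)) <=
               g w + (F w)%:E)%E.
    apply: ereal_inf_lbound; exists w => //.
    rewrite /phi_cl /Defs.indic ifT; first by rewrite dadde0 phiE.
    by rewrite inE; exact: subset_closure.
  case: (ereal_inf _) Hinf lb => [s| |]// _ lb; first by exists s.
  by exists 0 => w; apply: le_trans (lb w); exact: leey.
have [K K0 diag] := lyapunov_diag_le F2 H2 gN Hadm Hmin.
have [k k_gt0 low] :=
  lyapunov_near_ge F2 H2 pH gN glsc Hconst Hadm phi_bounded Hmin HT.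
(* Once [|x k + d k - xs| <= e |x k - xs|], [short_step_far] applies; the
   factor [32] is the one that it requires. *)
pose e := Num.min (1 / 4) (k / (32 * (K + 1))).
have e_gt0 : 0 < e.
  by rewrite lt_min !divr_gt0// mulr_gt0// ltr_wpDl.
have [e4 eK] : e <= 1 / 4 /\ K * e ^+ 2 <= k / 32.
  have e4 : e <= 1 / 4 by rewrite ge_min lexx.
  split=> //.
  have : e * (32 * (K + 1)) <= k.
    by rewrite -ler_pdivlMr ?ge_min ?lexx ?orbT// mulr_gt0// ltr_wpDl.
  have : K * e ^+ 2 <= K * e by rewrite ler_wpM2l// expr2 ler_piMl//; lra.
  by lra.
have dk_near := superlinear_le Hd e_gt0.
case: Hiter => _ _ _ iter.
have tauP j : tau j = 1 \/ 0 < tau j <= 1 / 2.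
  have [_ [[i ->] _ _] _ _] := iter j.
  case: i => [|i]; first by left; rewrite expr0 invr1.
  right; rewrite invr_gt0 exprn_gt0//= div1r lef_pV2 ?posrE ?exprn_gt0//.
  by rewrite exprS ler_peMr// exprn_ege1// ler1n.
have z_cvg : (fun j => x j + d j) @ \oo --> xs.
  apply: (cvg_enorm_dominated Hcvg); near=> j.
  have le_e : enorm (x j + d j - xs) <= e * enorm (x j - xs) by near: j.
  apply: (le_trans le_e); rewrite ler_piMl ?enorm_ge0//; lra.
have yE j : y j - xs = (1 - tau j) *: (x j - xs) + tau j *: (x j + d j - xs).
  have [_ _ -> _] := iter j.
  by apply/rowP => i; rewrite /trial_y !mxE; ring.
have y_cvg : y @ \oo --> xs.
  apply: (cvg_enorm_dominated Hcvg); near=> j.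
  have le_e : enorm (x j + d j - xs) <= e * enorm (x j - xs) by near: j.
  rewrite yE (le_trans (enormD _ _))// !enormZ.
  have [t0 t1] : 0 <= tau j /\ tau j <= 1 by have := tauP j; lra.
  rewrite !ger0_norm ?subr_ge0//.
  have := enorm_ge0 (x j - xs) => a0.
  have : tau j * enorm (x j + d j - xs) <= tau j * enorm (x j - xs).
    by rewrite ler_wpM2l// (le_trans le_e)// ler_piMl//; lra.
  lra.
have xS_cvg : (fun j => x j.+1) @ \oo --> xs.
  by have := cvg_shiftS x (nbhs xs) => ->.
have main : \forall j \near \oo, tau j = 1 /\ x j.+1 = x j + d j.
  near=> j.
  have [_ [_ acc lrg] yj xSj] := iter j.
  suff t1 : tau j = 1.
    by split=> //; rewrite xSj t1 /trial_x subrr scale0r scale1r add0r.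
  have [//|tauj] := tauP j; exfalso.
  have [_ _ acc_le] := acc.
  have nacc : ~ accepted setT (EFin \o F) g (EFin \o H) gamma beta c xi delta
      (x j) (y_prev xm1 y j) (xbar j) (d j) 1.
    by move=> acc1; have := lrg 0%N; rewrite expr0 invr1 => /(_ acc1); lra.
  (* The tests for [1] and for [tau j] have the same right-hand side. *)
  have lt_1 : (lyapunov (EFin \o F) g (EFin \o H) gamma beta c xi
      (x j.+1) (y j) < lyapunov (EFin \o F) g (EFin \o H) gamma beta c xi
      (x j + d j) (x j + d j))%E.
    rewrite xSj yj; apply: (le_lt_trans acc_le).
    rewrite ltNge; apply/negP => le_1; apply: nacc; split=> //.
    by rewrite /trial_x /trial_y subrr scale0r add0r !scale1r.
  have le_low : ((fine (g xs) + F xs + k * (enorm (x j.+1 - xs) ^+ 2 +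
      enorm (x j.+1 - y j) ^+ 2))%:E <= lyapunov (EFin \o F) g (EFin \o H)
      gamma beta c xi (x j.+1) (y j))%E.
    have [Tj _ _ _] := iter j.+1.
    move: (xbar j.+1) Tj; near: j.
    exact: (cvg_pair xS_cvg y_cvg low).
  have le_diag : (lyapunov (EFin \o F) g (EFin \o H) gamma beta c xi
      (x j + d j) (x j + d j) <= (fine (g xs) + F xs +
      K * enorm (x j + d j - xs) ^+ 2)%:E)%E.
    by near: j; exact: (z_cvg _ diag).
  have := lt_le_trans (le_lt_trans le_low lt_1) le_diag.
  rewrite lte_fin ltrD2l ltNge => /negP; apply.
  apply: (short_step_far (x j.+1) tauj (yE j) _ e_gt0 e4 (ltW k_gt0) K0 eK).
  by near: j.
split=> //; move: Hd; rewrite /superlinear_rate /superlinear_directions.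
apply: cvg_trans; apply: near_eq_cvg; near=> j.
by have [_ ->] : tau j = 1 /\ x j.+1 = x j + d j by near: j.
Unshelve. all: by end_near. Qed.
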